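(* Let $\mathcal{C}\subset\mathbb{R}^n$ be a compact convex set with nonempty interior, let $f:\mathbb{R}^n\to\mathbb{R}$ be a differentiable convex function, let $X^*=\operatorname{argmin}_{x\in\mathcal{C}}f(x)$, $f^*=\min_{x\in\mathcal{C}}f(x)$, and let $K$ be a compact neighborhood of $X^*$ in $\mathcal{C}$. Assume that $f$ satisfies the $(\theta,c)$-Hölderian error bound on $K$ and that $\mathcal{C}$ satisfies the $\delta$-scaling inequality. Then, with $r=\frac{1}{1-\theta}$, for all $x\in K$, $$f(x)-f^*\le\Big(\frac{c}{\delta}\Big)^{r} w(x)^{r}.$$
   Context: $\|\cdot\|$ is a fixed norm on $\mathbb{R}^n$. $\operatorname{Ext}(\mathcal{C})$ is the set of extreme points of $\mathcal{C}$. A finite set $\mathcal{S}\subset\operatorname{Ext}(\mathcal{C})$ is a proper support of $x\in\mathcal{C}$ if $x$ is a convex combination of the elements of $\mathcal{S}$ with all weights positive; $\mathcal{S}_x$ is the set of proper supports of $x$. The strong Wolfe gap is $$w(x)=\min_{\mathcal{S}\in\mathcal{S}_x}\ \max_{y\in\mathcal{S},\,z\in\mathcal{C}}\nabla f(x)^T(y-z)$$ (read as an infimum if the minimum is not attained). $(\theta,c)$-Hölderian error bound on $K$, with $\theta\in[0,1/2]$ and $c>0$: for all $x\in K$, $\min_{x^*\in X^*}\|x-x^*\|\le c\,(f(x)-f^* )^\theta$. $\delta$-scaling inequality for $\mathcal{C}$, with $\delta=\delta(\mathcal{C})>0$: for every differentiable convex function $f$, with $X^*$ its set of minimizers over $\mathcal{C}$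 and $w$ its strong Wolfe gap, and every $x\in\mathcal{C}\setminus X^*$, $$w(x)\ge\delta\,\max_{x^*\in X^*}\Big\langle\nabla f(x),\frac{x-x^*}{\|x-x^*\|}\Big\rangle.$$ *)

(* Defs.v *)
From HB Require Import structures.
From mathcomp Require Import all_boot all_order all_algebra finmap.
From mathcomp Require Import all_classical all_reals all_analysis.

Set Implicit Arguments.
Unset Strict Implicit.
Unset Printing Implicit Defensive.

Import Order.TTheory GRing.Theory Num.Theory.
Import numFieldNormedType.Exports.

Local Open Scope classical_set_scope.
Local Open Scope ring_scope.

(* The canonical norm of ['rV[R]_n] is the sup norm: it only provides the
   topology and the differential structure, which do not depend on the norm.
   The norm of the statements is an arbitrary [N] satisfying [is_norm N]. *)
Record is_norm (R : realType) (n : nat) (N : 'rV[R]_n -> R) : Prop := IsNorm {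
  is_norm_triangle : forall u v, N (u + v) <= N u + N v ;
  is_norm_scale : forall (a : R) u, N (a *: u) = `|a| * N u ;
  is_norm_eq0 : forall u, N u = 0 -> u = 0 }.

Definition dot (R : realType) (n : nat) (u v : 'rV[R]_n) : R :=
  \sum_(i < n) u 0 i * v 0 i.

Definition gradient (R : realType) (n : nat) (f : 'rV[R]_n -> R)
    (x : 'rV[R]_n) : 'rV[R]_n :=
  \row_(i < n) 'D_(delta_mx 0 i) f x.

Definition argmin (R : realType) (n : nat) (f : 'rV[R]_n -> R)
    (C : set 'rV[R]_n) : set 'rV[R]_n :=
  [set x | C x /\ forall y, C y -> f x <= f y].

Definition minval (R : realType) (n : nat) (f : 'rV[R]_n -> R)
    (C : set 'rV[R]_n) : R :=
  inf [set f x | x in C].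

Definition Ext (R : realType) (n : nat) (C : set 'rV[R]_n) : set 'rV[R]_n :=
  [set x | C x /\ forall y z (t : R), C y -> C z -> 0 < t -> t < 1 ->
     x = t *: y + (1 - t) *: z -> y = x /\ z = x].

Definition proper_support (R : realType) (n : nat) (C : set 'rV[R]_n)
    (x : 'rV[R]_n) (S : {fset 'rV[R]_n}) : Prop :=
  (forall y, y \in S -> Ext C y) /\
  exists lambda : 'rV[R]_n -> R,
    [/\ forall y, y \in S -> 0 < lambda y,
        \sum_(y <- S) lambda y = 1
      & x = \sum_(y <- S) lambda y *: y].

(* For [C] compact convex and [x] in [C], the sets below are nonempty and
   bounded on the relevant side, so the real-valued [sup] and [inf] do not take
   their default value. *)
Definition wolfe_gap (R : realType) (n : nat) (C : set 'rV[R]_n)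
    (f : 'rV[R]_n -> R) (x : 'rV[R]_n) : R :=
  inf [set sup [set dot (gradient f x) (y - z) | y in [set` S] & z in C]
      | S in proper_support C x].

Definition compact_neighborhood_in (R : realType) (n : nat)
    (C A K : set 'rV[R]_n) : Prop :=
  [/\ compact K, K `<=` C
    & exists U : set 'rV[R]_n, [/\ open U, A `<=` U & U `&` C `<=` K]].

(* [powR] has [0 `^ 0 = 1]; the convention is irrelevant here, since
   [f x = minval f C] means that [x] is a minimizer, at distance 0. *)
Definition holder_error_bound (R : realType) (n : nat) (N : 'rV[R]_n -> R)
    (C : set 'rV[R]_n) (f : 'rV[R]_n -> R) (theta c : R)
    (K : set 'rV[R]_n) : Prop :=
  [/\ 0 <= theta, theta <= 1 / 2, 0 < c
    & forall x, K x ->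
        inf [set N (x - xs) | xs in argmin f C]
          <= c * (f x - minval f C) `^ theta].

Definition scaling_inequality (R : realType) (n : nat) (N : 'rV[R]_n -> R)
    (C : set 'rV[R]_n) (delta : R) : Prop :=
  0 < delta /\
  forall f : 'rV[R]_n -> R,
    (forall x, differentiable f x) -> convex_function setT f ->
    forall x, C x -> ~ argmin f C x ->
      delta * sup [set dot (gradient f x) ((N (x - xs))^-1 *: (x - xs))
                  | xs in argmin f C]
        <= wolfe_gap C f x.

(* Main.v *)
Require Import Defs.
From HB Require Import structures.
From mathcomp Require Import all_boot all_order all_algebra finmap.
From mathcomp Require Import all_classical all_reals all_analysis.
From mathcomp Require Import ring lra.

Set Implicit Arguments.
Unset Strict Implicit.
Unset Printing Implicit Defensive.

Import Order.TTheory GRing.Theory Num.Theory.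
Import numFieldNormedType.Exports.

Local Open Scope classical_set_scope.
Local Open Scope ring_scope.

(** Write [h = f x - f^*], [w] for the strong Wolfe gap at [x] and [X^*] for the
    set of minimizers.  At a minimizer [h = 0] and there is nothing to prove.

    Otherwise convexity puts [f] above its tangent at [x], so for every
    minimizer [b] the slope [<grad f x, x - b>] is at least [h]
    ([convex_tangent_le]).  Dividing by [N (x - b)], the scaling inequality
    gives [delta * h <= w * N (x - b)] ([scaling_gap_le]).  In particular
    [w > 0], and taking the infimum over [b] and inserting the error bound,
    [delta * h / w <= c * h `^ theta].  Thus
    [h <= (c / delta * w) * h `^ theta], and solving for [h], which is possible
    since [theta < 1], is the claimed rate ([holder_rate]).

    The supremum in the scaling inequality is a real number, so it dominates
    the quotient at [b] only if these quotients are bounded above over [X^*].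
    They are, being the values of a continuous function on a compact set: [X^*]
    is compact ([argmin_compact]), [N (x - b)] does not vanish on it, and an
    arbitrary norm is continuous for the coordinate topology
    ([is_norm_continuous]). *)

(** * Minimizers over a compact set *)

Lemma minval_argmin (R : realType) (n : nat) (f : 'rV[R]_n -> R)
    (C : set 'rV[R]_n) (x : 'rV[R]_n) :
  argmin f C x -> minval f C = f x.
Proof.
move=> [Cx fx]; apply/le_anti/andP; split.
  by apply: ge_inf; [exists (f x) => _ [y Cy <-]; exact: fx | exists x].
by apply: lb_le_inf; [exists (f x), x | move=> _ [y Cy <-]; exact: fx].
Qed.

Lemma argmin_nonempty (R : realType) (n : nat) (f : 'rV[R]_n -> R)
    (C : set 'rV[R]_n) :
  compact C -> C !=set0 -> continuous f -> argmin f C !=set0.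
Proof.
move=> cC C0 cf.
have [|x xC fx] := EVT_min_rV C0 cC (f := f); first exact: continuous_subspaceT.
by exists x; split; [exact/set_mem | move=> y Cy; apply/fx/mem_set].
Qed.

(** Given one minimizer [a], the others are cut out of [C] by the closed
    condition [f x <= f a]. *)
Lemma argmin_compact (R : realType) (n : nat) (f : 'rV[R]_n -> R)
    (C : set 'rV[R]_n) :
  compact C -> continuous f -> compact (argmin f C).
Proof.
move=> cC cf.
have [[a aX]|X0] := pselect (argmin f C !=set0); last first.
  suff -> : argmin f C = set0 by exact: compact0.
  by apply/seteqP; split => // x xX; apply: X0; exists x.
have -> : argmin f C = C `&` f @^-1` [set t | t <= f a].
  apply/seteqP; split => x [Cx fx]; split => //=; first exact/fx/aX.1.
  by move=> y Cy; apply: le_trans fx (aX.2 _ Cy).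
apply: compact_closedI => //.
by apply: closed_comp => [y _|]; [exact: cf | exact: closed_le].
Qed.

(** * Continuity of norms and scalar products *)

Lemma continuous_sum (R : realType) (T : topologicalType) (n : nat)
    (F : 'I_n -> T -> R) :
  (forall i, continuous (F i)) -> continuous (fun x => \sum_(i < n) F i x).
Proof.
by move=> cF; apply: continuous_big => //; exact: (@add_continuous R).
Qed.

Lemma is_norm0 (R : realType) (n : nat) (N : 'rV[R]_n -> R) :
  is_norm N -> N 0 = 0.
Proof. by move=> hN; rewrite -(scale0r 0) (is_norm_scale hN) normr0 mul0r. Qed.

Lemma is_normN (R : realType) (n : nat) (N : 'rV[R]_n -> R) (u : 'rV[R]_n) :
  is_norm N -> N (- u) = N u.
Proof. by move=> hN; rewrite -scaleN1r (is_norm_scale hN) normrN1 mul1r. Qed.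

Lemma is_norm_ge0 (R : realType) (n : nat) (N : 'rV[R]_n -> R) (u : 'rV[R]_n) :
  is_norm N -> 0 <= N u.
Proof.
move=> hN; have := is_norm_triangle hN u (- u).
by rewrite subrr (is_norm0 hN) (is_normN _ hN) -mulr2n pmulrn_lge0.
Qed.

Lemma is_norm_gt0 (R : realType) (n : nat) (N : 'rV[R]_n -> R) (u : 'rV[R]_n) :
  is_norm N -> u != 0 -> 0 < N u.
Proof.
move=> hN u0; rewrite lt_neqAle is_norm_ge0// andbT eq_sym.
by apply: contra u0 => /eqP/(is_norm_eq0 hN)/eqP.
Qed.

(** The triangle inequality along the canonical basis: this is what compares an
    arbitrary norm with the coordinates, hence with the topology. *)
Lemma is_norm_le_coord (R : realType) (n : nat) (N : 'rV[R]_n -> R)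
    (u : 'rV[R]_n) :
  is_norm N -> N u <= \sum_(i < n) `|u 0 i| * N (delta_mx 0 i).
Proof.
move=> hN; rewrite [in leLHS](row_sum_delta u).
elim/big_ind2 : _ => [|a b c d ab cd|i _]; first by rewrite is_norm0.
  exact: le_trans (is_norm_triangle hN _ _) (lerD ab cd).
by rewrite (is_norm_scale hN).
Qed.

Lemma is_norm_dist (R : realType) (n : nat) (N : 'rV[R]_n -> R)
    (u v : 'rV[R]_n) :
  is_norm N -> `|N u - N v| <= N (u - v).
Proof.
move=> hN; rewrite ler_norml; apply/andP; split.
  rewrite lerNl opprB lerBlDr -(is_normN (u - v) hN) opprB.
  by rewrite -[in leLHS](subrK u v); exact: is_norm_triangle.
by rewrite lerBlDr -[in leLHS](subrK v u); exact: is_norm_triangle.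
Qed.

(** [N] is 1-Lipschitz for itself, and [N (u - v)] is dominated by a combination
    of the coordinates of [u - v], which vanishes as [u] tends to [v]. *)
Lemma is_norm_continuous (R : realType) (n : nat) (N : 'rV[R]_n -> R) :
  is_norm N -> continuous N.
Proof.
move=> hN v.
pose g (u : 'rV[R]_n) := \sum_(i < n) `|(u - v) 0 i| * N (delta_mx 0 i).
have g0 : g u @[u --> v] --> (0 : R).
  have -> : 0 = g v.
    by rewrite /g big1// => i _; rewrite subrr mxE normr0 mul0r.
  have gc : continuous g.
    apply: continuous_sum => i u.
    apply: (@cvgMr_tmp R _ (nbhs u) _ (fun u => `|(u - v) 0 i|)).
    apply: cvg_norm.
    under eq_cvg do rewrite !mxE.
    by rewrite !mxE; apply: cvgB; [exact: coord_continuous | exact: cvg_cst].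
  exact: gc.
apply/(@cvgrPdist_le _ R^o _ _ (nbhs_filter v)) => e e0; near=> u.
rewrite distrC (le_trans (is_norm_dist _ _ hN))//.
rewrite (le_trans (is_norm_le_coord _ hN))//.
by near: u; exact: (cvgr_le 0 g0).
Unshelve. all: by end_near. Qed.

Lemma dot_continuous (R : realType) (n : nat) (u : 'rV[R]_n) :
  continuous (dot u).
Proof.
apply: continuous_sum => i v.
by apply: (@cvgMl_tmp R _ (nbhs v) _ (fun v : 'rV[R]_n => v 0 i));
  exact: coord_continuous.
Qed.

(** * First-order convexity *)

Lemma dotZr (R : realType) (n : nat) (u v : 'rV[R]_n) (a : R) :
  dot u (a *: v) = a * dot u v.
Proof. by rewrite /dot mulr_sumr; apply: eq_bigr => i _; rewrite mxE mulrCA. Qed.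

Lemma dotNr (R : realType) (n : nat) (u v : 'rV[R]_n) :
  dot u (- v) = - dot u v.
Proof. by rewrite -scaleN1r dotZr mulN1r. Qed.

(** The differential is linear, so it is determined by the partial derivatives,
    which are the entries of the gradient. *)
Lemma dot_gradient (R : realType) (n : nat) (f : 'rV[R]_n -> R)
    (x v : 'rV[R]_n) :
  differentiable f x -> dot (gradient f x) v = 'D_v f x.
Proof.
move=> df; rewrite deriveE// [in RHS](row_sum_delta v) linear_sum.
by apply: eq_bigr => i _; rewrite linearZ mxE deriveE// mulrC.
Qed.

(** By convexity the difference quotients of [f] at [x] in the direction [y - x]
    are at most [f y - f x] for steps between 0 and 1; the directional
    derivative is their limit. *)
Lemma convex_tangent_le (R : realType) (n : nat) (f : 'rV[R]_n -> R)
    (x y : 'rV[R]_n) :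
  differentiable f x -> convex_function setT f ->
  dot (gradient f x) (y - x) <= f y - f x.
Proof.
move=> df cf; rewrite dot_gradient// /derive.
have dfx : derivable f x (y - x) by exact: diff_derivable.
rewrite (cvg_at_rightE _ _ dfx); apply: limr_le.
  by apply: cvgP; apply: cvg_dnbhs_at_right; exact: dfx.
near=> h.
have h0 : 0 < h by near: h; exact: nbhs_right_gt.
have h1 : h <= 1 by near: h; exact: nbhs_right_le.
have /= := cf (Itv01 (ltW h0) h1) y x (mem_setT _) (mem_setT _).
rewrite convRE /= => hxy.
rewrite -[_ *: _]/(_ * _) ler_pdivrMl// lerBlDr.
have -> : h *: (y - x) + x = h *: y + (1 - h) *: x.
  by rewrite scalerBr scalerBl scale1r addrAC addrA.
by apply: le_trans hxy _; rewrite /unstable.onem; lra.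
Unshelve. all: by end_near. Qed.

(** * The error estimate *)

(** Dividing by [a `^ theta] leaves [a `^ (1 - theta) <= b]; the exponent on the
    right is the inverse of [1 - theta]. *)
Lemma holder_rate (R : realType) (theta a b : R) :
  theta < 1 -> 0 < a -> a <= b * a `^ theta -> a <= b `^ (1 / (1 - theta)).
Proof.
move=> th1 a0 ab.
have p0 : 0 < a `^ theta by rewrite powR_gt0.
have ab' : a `^ (1 - theta) <= b.
  rewrite powRB; last by rewrite (gt_eqF a0) implybT.
  by rewrite powRr1 ?(ltW a0)// ler_pdivrMr.
have t0 : 0 < 1 - theta by rewrite subr_gt0.
have -> : a = (a `^ (1 - theta)) `^ (1 / (1 - theta)).
  by rewrite -powRrM mulrC divfK ?gt_eqF// powRr1// ltW.
apply: ge0_ler_powR => //; rewrite ?divr_ge0 ?(ltW t0)// nnegrE ?powR_ge0//.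
by rewrite (le_trans _ ab')// powR_ge0.
Qed.

(** The scaling inequality in the form in which it is used, with its normalized
    slope replaced by the decrease [f x - f a] that it bounds.  Keeping [a]
    arbitrary allows [N (x - a)] to be minimized afterwards. *)
Lemma scaling_gap_le (R : realType) (n : nat) (N : 'rV[R]_n -> R)
    (C : set 'rV[R]_n) (f : 'rV[R]_n -> R) (delta : R) (x a : 'rV[R]_n) :
  is_norm N -> compact C ->
  (forall x, differentiable f x) -> convex_function setT f ->
  scaling_inequality N C delta ->
  C x -> ~ argmin f C x -> argmin f C a ->
  delta * (f x - f a) <= wolfe_gap C f x * N (x - a).
Proof.
move=> hN cC df cf [d0 hd] Cx nx Xa.
have fc : continuous f by move=> y; exact/differentiable_continuous.
have Npos b : argmin f C b -> 0 < N (x - b).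
  move=> Xb; apply: is_norm_gt0 => //; rewrite subr_eq0.
  by apply/eqP => xb; apply: nx; rewrite xb.
pose phi (b : 'rV[R]_n) := dot (gradient f x) ((N (x - b))^-1 *: (x - b)).
have phiE b : phi b = dot (gradient f x) (x - b) / N (x - b).
  by rewrite /phi dotZr mulrC.
have phic : {within argmin f C, continuous phi}.
  apply: continuous_in_subspaceT => b /set_mem Xb.
  have sc : {for b, continuous (fun b : 'rV[R]_n => x - b)}.
    by apply: (@cvgB _ 'rV[R]_n _ (nbhs b)); [exact: cvg_cst | exact: cvg_id].
  rewrite (_ : phi = fun b : 'rV[R]_n =>
      dot (gradient f x) (x - b) * (N (x - b))^-1).
    apply: (@cvgM R _ (nbhs b)).
      by apply: continuous_comp; [exact: sc | exact: dot_continuous].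
    apply: cvgV; first by rewrite gt_eqF// Npos.
    by apply: continuous_comp; [exact: sc | exact: is_norm_continuous].
  by apply/funext => ?; exact: phiE.
(* Boundedness of the quotients: without it [sup] would be a default value. *)
have [m mX phim] : exists2 m, m \in argmin f C &
    forall b, b \in argmin f C -> phi b <= phi m.
  by apply: EVT_max_rV => //; [exists a | exact: argmin_compact].
have phisup : phi a <= sup [set phi b | b in argmin f C].
  apply: ub_le_sup; last by exists a.
  by exists (phi m) => _ [b Xb <-]; exact/phim/mem_set.
have tangent : f x - f a <= dot (gradient f x) (x - a).
  by rewrite -lerN2 -dotNr !opprB; exact: convex_tangent_le.
have gap := hd f df cf x Cx nx.
rewrite -ler_pdivrMr ?Npos//; apply: le_trans gap.
rewrite -mulrA ler_pM2l//; apply: le_trans phisup.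
by rewrite phiE ler_pM2r// invr_gt0 Npos.
Qed.

Theorem lemma3p6 (R : realType) (n : nat) (N : 'rV[R]_n -> R)
    (C : set 'rV[R]_n) (f : 'rV[R]_n -> R) (K : set 'rV[R]_n)
    (theta c delta : R) :
  is_norm N ->
  compact C -> convex_set C -> interior C !=set0 ->
  (forall x, differentiable f x) -> convex_function setT f ->
  compact_neighborhood_in C (argmin f C) K ->
  holder_error_bound N C f theta c K ->
  scaling_inequality N C delta ->
  let r := 1 / (1 - theta) in
  forall x, K x ->
    f x - minval f C <= (c / delta) `^ r * (wolfe_gap C f x) `^ r.
Proof.
move=> hN cC _ _ df cf [_ KC _] [_ th2 c0 heb] hsc r x Kx.
have Cx := KC _ Kx.
have d0 : 0 < delta by case: hsc.
have fc : continuous f by move=> y; exact/differentiable_continuous.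
have [a Xa] : argmin f C !=set0 by apply: argmin_nonempty => //; exists x.
have [Xx|nx] := pselect (argmin f C x).
  by rewrite (minval_argmin Xx) subrr mulr_ge0// powR_ge0.
set w := wolfe_gap C f x; set h := f x - minval f C.
have h0 : 0 < h.
  rewrite /h (minval_argmin Xa) subr_gt0 ltNge; apply/negP => fxa.
  by apply: nx; split => // y Cy; exact: le_trans fxa (Xa.2 _ Cy).
(* This holds for every minimizer, so it survives the infimum in the error
   bound. *)
have gap b : argmin f C b -> delta * h <= w * N (x - b).
  by move=> Xb; rewrite /h (minval_argmin Xb); exact: scaling_gap_le.
have w0 : 0 < w.
  rewrite ltNge; apply/negP => w_le0; have := gap a Xa; apply/negP.
  by rewrite -ltNge (le_lt_trans _ (mulr_gt0 d0 h0))// mulr_le0_ge0 ?is_norm_ge0.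
have dist : delta * h / w <= c * h `^ theta.
  apply: le_trans (heb x Kx); apply: lb_le_inf; first by exists (N (x - a)), a.
  by move=> _ [b Xb <-]; rewrite ler_pdivrMr// [leRHS]mulrC gap.
have th1 : theta < 1 by lra.
rewrite -powRM ?divr_ge0 ?(ltW c0) ?(ltW d0) ?(ltW w0)//.
apply: holder_rate => //.
rewrite ler_pdivrMr// in dist.
rewrite -(ler_pM2l d0); apply: le_trans dist _.
by rewrite le_eqVlt; apply/orP; left; apply/eqP; field; rewrite gt_eqF.
Qed.
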